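(* Let $A$ be a commutative Noetherian ring. The monoid $(ic(A),* )$ has the following properties: (i) $ic(A)$ is conical, that is, if $I*J=(1)$ then $I=J=(1)$; (ii) $ic(A)$ is reduced, i.e. the only invertible element is the identity $(1)$; (iii) $ic(A)$ is torsion-free.
   Context: For an ideal $I$ of a commutative Noetherian ring $A$, the integral closure is $\overline{I}=\{x\in A : x^n+a_1x^{n-1}+\dots+a_n=0 \text{ for some } n\ge 1,\ a_i\in I^i\}$; $I$ is integrally closed if $\overline{I}=I$. Define $ic(A)=\{I : I \text{ is an integrally closed ideal of } A \text{ containing a nonzerodivisor}\}$, with operation $I*J=\overline{IJ}$; this is a commutative monoid with identity $(1)$. A commutative monoid is torsion-free if $a^n=b^n$ for some integer $n\ge1$ implies $a=b$; in $ic(A)$ the $n$-th power of $I$ is $\overline{I^n}$. *)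

(* Defs.v *)
From HB Require Import structures.
From mathcomp Require Import all_boot all_order all_algebra.
From mathcomp Require Import boolp classical_sets.
Set Implicit Arguments.
Unset Strict Implicit.
Unset Printing Implicit Defensive.
Import GRing.Theory.
Local Open Scope ring_scope.
Local Open Scope classical_set_scope.

(* MathComp's [idealr] is not used: its ideals are proper, which excludes
   the unit ideal (1). *)
Definition is_ideal (A : comPzRingType) (I : set A) : Prop :=
  [/\ I 0, forall x y, I x -> I y -> I (x + y)
    & forall a x, I x -> I (a * x)].

Definition noetherian (A : comPzRingType) : Prop :=
  forall I : set A, is_ideal I -> exists (n : nat) (g : 'I_n -> A),
    I = [set x | exists c : 'I_n -> A, x = \sum_(i < n) c i * g i].

Definition nonzerodivisor (A : comPzRingType) (x : A) : Prop :=
  forall y, x * y = 0 -> y = 0.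

Definition ideal_mul (A : comPzRingType) (I J : set A) : set A :=
  [set x | exists (n : nat) (a b : 'I_n -> A),
    [/\ forall i, I (a i), forall i, J (b i) & x = \sum_(i < n) a i * b i]].

(* ideal_pow I 0 is the unit ideal. *)
Definition ideal_pow (A : comPzRingType) (I : set A) (n : nat) : set A :=
  iter n (ideal_mul I) setT.

Definition integral_closure (A : comPzRingType) (I : set A) : set A :=
  [set x | exists (n : nat) (a : nat -> A),
    [/\ (0 < n)%N,
        forall i, (0 < i <= n)%N -> ideal_pow I i (a i)
      & x ^+ n + \sum_(1 <= i < n.+1) a i * x ^+ (n - i) = 0]].

Definition integrally_closed (A : comPzRingType) (I : set A) : Prop :=
  integral_closure I = I.

Record ic (A : comPzRingType) := IC {
  ic_set :> set A;
  ic_ideal : is_ideal ic_set;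
  ic_closed : integrally_closed ic_set;
  ic_regular : exists2 x, ic_set x & nonzerodivisor x }.

Lemma ic_inj (A : comPzRingType) (I J : ic A) : ic_set I = ic_set J -> I = J.
Proof.
case: I J => [I i1 i2 i3] [J j1 j2 j3] /= IJ; case: _ / IJ j1 j2 j3 => *.
by congr IC; apply: Prop_irrelevance.
Qed.

Section Ideals.
Variable A : comPzRingType.
Implicit Types (I J K : set A) (x y : A).

Lemma is_ideal_setT : is_ideal (@setT A). Proof. by []. Qed.

Lemma is_ideal_sum I n (f : 'I_n -> A) :
  is_ideal I -> (forall i, I (f i)) -> I (\sum_i f i).
Proof. by case=> I0 ID _ If; elim/big_ind: _. Qed.

Lemma ideal_mul0 I J : ideal_mul I J 0.
Proof.
exists 0%N, (fun=> 0), (fun=> 0); split; try by case.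
by rewrite big_ord0.
Qed.

Lemma ideal_mulD I J x y :
  ideal_mul I J x -> ideal_mul I J y -> ideal_mul I J (x + y).
Proof.
move=> [n [a [b [Ia Jb ->]]]] [m [c [d [Ic Jd ->]]]].
exists (n + m)%N,
  (fun k => match split k with inl i => a i | inr j => c j end),
  (fun k => match split k with inl i => b i | inr j => d j end).
split=> [k|k|]; try by case: split.
rewrite big_split_ord /=; congr (_ + _); apply: eq_bigr => k _.
  by case: split (unsplitK (inl k : 'I_n + 'I_m)%type) => // ? [->].
by case: split (unsplitK (inr k : 'I_n + 'I_m)%type) => // ? [->].
Qed.

Lemma ideal_mulM I J x y : I x -> J y -> ideal_mul I J (x * y).
Proof.
by move=> Ix Jy; exists 1%N, (fun=> x), (fun=> y); rewrite big_ord1.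
Qed.

Lemma ideal_mul_sub I J (P : A -> Prop) :
    P 0 -> (forall x y, P x -> P y -> P (x + y)) ->
    (forall x y, I x -> J y -> P (x * y)) ->
  forall x, ideal_mul I J x -> P x.
Proof.
move=> P0 PD PM x [n [a [b [Ia Jb ->]]]].
by elim/big_ind: _ => // i _; apply: PM.
Qed.

Lemma is_ideal_mul I J : is_ideal J -> is_ideal (ideal_mul I J).
Proof.
move=> [_ _ JM]; split; [exact: ideal_mul0|exact: ideal_mulD|move=> c x].
elim/ideal_mul_sub: x / => [|x y|x y Ix Jy].
- by rewrite mulr0; apply: ideal_mul0.
- by rewrite mulrDr; apply: ideal_mulD.
- by rewrite mulrCA; apply: ideal_mulM => //; apply: JM.
Qed.

Lemma is_ideal_pow I n : is_ideal (ideal_pow I n).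
Proof. by elim: n => //= n; apply: is_ideal_mul. Qed.

Lemma ideal_mulC I J : ideal_mul I J = ideal_mul J I.
Proof.
by apply/seteqP; split; apply: ideal_mul_sub;
  do ?[exact: ideal_mul0|exact: ideal_mulD]; move=> x y ? ?;
  rewrite mulrC; apply: ideal_mulM.
Qed.

Lemma ideal_mulS I I' J J' :
  I `<=` I' -> J `<=` J' -> ideal_mul I J `<=` ideal_mul I' J'.
Proof.
move=> sI sJ; apply: ideal_mul_sub;
  do ?[exact: ideal_mul0|exact: ideal_mulD].
by move=> x y /sI ? /sJ ?; apply: ideal_mulM.
Qed.

Lemma ideal_mulA I J K :
  ideal_mul I (ideal_mul J K) = ideal_mul (ideal_mul I J) K.
Proof.
apply/seteqP; split; apply: ideal_mul_sub;
  do ?[exact: ideal_mul0|exact: ideal_mulD] => x y.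
  move=> Ix; elim/ideal_mul_sub: y / => [|y z|y z Jy Kz].
  - by rewrite mulr0; apply: ideal_mul0.
  - by rewrite mulrDr; apply: ideal_mulD.
  - by rewrite mulrA; apply: ideal_mulM => //; apply: ideal_mulM.
move=> + Ky; elim/ideal_mul_sub: x / => [|x z|x z Ix Jz].
- by rewrite mul0r; apply: ideal_mul0.
- by rewrite mulrDl; apply: ideal_mulD.
- by rewrite -mulrA; apply: ideal_mulM => //; apply: ideal_mulM.
Qed.

Lemma ideal_mul1 I : is_ideal I -> ideal_mul setT I = I.
Proof.
move=> [I0 ID IM]; apply/seteqP; split=> [|x Ix].
  by apply: ideal_mul_sub => // x y _; apply: IM.
by rewrite -[x]mul1r; apply: ideal_mulM.
Qed.

Lemma ideal_powS I J n : I `<=` J -> ideal_pow I n `<=` ideal_pow J n.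
Proof. by move=> sIJ; elim: n => //= n; apply: ideal_mulS. Qed.

Lemma ideal_powD I m n x y :
  ideal_pow I m x -> ideal_pow I n y -> ideal_pow I (m + n) (x * y).
Proof.
move=> + Iy; elim: m x => [|m IHm] x /=.
  by move=> _; case: (is_ideal_pow I n) => _ _; apply.
elim/ideal_mul_sub: x / => [|x z|x z Ix /IHm Iz].
- by rewrite mul0r; apply: ideal_mul0.
- by rewrite mulrDl; apply: ideal_mulD.
- by rewrite -mulrA; apply: ideal_mulM.
Qed.

Lemma ideal_powX I n x : I x -> ideal_pow I n (x ^+ n).
Proof. by move=> Ix; elim: n => //= n IHn; rewrite exprS; apply: ideal_mulM. Qed.

Lemma ideal_powM I J n x y :
  ideal_pow I n x -> ideal_pow J n y -> ideal_pow (ideal_mul I J) n (x * y).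
Proof.
elim: n x y => //= n IHn x y.
elim/ideal_mul_sub: x / => [|x z|x z Ix Iz].
- by rewrite mul0r => _; apply: ideal_mul0.
- by rewrite mulrDl => Hx Hz Hy; apply: ideal_mulD; [apply: Hx|apply: Hz].
elim/ideal_mul_sub: y / => [|y t|y t Jy Jt].
- by rewrite mulr0; apply: ideal_mul0.
- by rewrite mulrDr; apply: ideal_mulD.
- by rewrite mulrACA; apply: ideal_mulM; [apply: ideal_mulM|apply: IHn].
Qed.

Lemma integral_closureS I J :
  I `<=` J -> integral_closure I `<=` integral_closure J.
Proof.
move=> sIJ x [n [a [n0 Ia xE]]]; exists n, a; split=> // i /Ia.
exact: ideal_powS.
Qed.

Lemma sub_integral_closure I : I `<=` integral_closure I.
Proof.
move=> x Ix; exists 1%N, (fun=> - x); split=> // [i|]; last first.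
  by rewrite big_nat1 expr1 subnn expr0 mulr1 subrr.
case: i => [|[|]] //= _; rewrite -[x]mulr1 -mulrN.
exact: ideal_mulM.
Qed.

Lemma integral_closureZ I J x y :
  integral_closure I x -> J y -> integral_closure (ideal_mul I J) (x * y).
Proof.
move=> [n [a [n0 Ia xE]]] Jy; exists n, (fun i => a i * y ^+ i).
split=> // [i /Ia Iai|]; first by apply: ideal_powM => //; apply: ideal_powX.
have := congr1 ( *%R^~ (y ^+ n)) xE.
rewrite /= mul0r mulrDl -exprMn mulr_suml; apply: etrans; congr (_ + _).
apply: eq_big_nat => i /andP[_]; rewrite ltnS => lein.
by rewrite exprMn mulrACA -exprD subnKC.
Qed.

Lemma integral_closure0 I : integral_closure I 0.
Proof.
exists 1%N, (fun=> 0); split=> // [i _|]; first by case: (is_ideal_pow I i).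
by rewrite big_nat1 mul0r addr0.
Qed.

End Ideals.

(* x is integral over I iff xT is integral over the Rees ring, i.e. the subring
   of A[T] of the polynomials whose coefficient of T^i lies in I^i; hence the
   closure of I is an ideal and closing it again adds nothing. *)
Section Rees.
Variables (A : comNzRingType) (I : set A).

Definition rees_pred : {pred {poly A}} :=
  fun p => `[< forall i, ideal_pow I i p`_i >].

Lemma reesP (p : {poly A}) : reflect (forall i, ideal_pow I i p`_i) (p \in rees_pred).
Proof. exact: asboolP. Qed.

Lemma rees_closed : subring_closed rees_pred.
Proof.
split=> [|p q /reesP Ip /reesP Iq|p q /reesP Ip /reesP Iq]; apply/reesP => i.
- by rewrite coef1; case: i => // i; case: (is_ideal_pow I i.+1).
- rewrite coefB -mulN1r; have [_ ID IM] := is_ideal_pow I i.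
  by apply: ID => //; apply: IM.
rewrite coefM; apply: is_ideal_sum => [|j]; first exact: is_ideal_pow.
by rewrite -{1}(subnKC (leq_ord j)); apply: ideal_powD.
Qed.

HB.instance Definition _ := GRing.isSubringClosed.Build _ rees_pred rees_closed.

Record rees := Rees { rees_val : {poly A}; _ : rees_val \in rees_pred }.
HB.instance Definition _ := [isSub for rees_val].
HB.instance Definition _ := [Choice of rees by <:].
HB.instance Definition _ := [SubChoice_isSubComNzRing of rees by <:].

Definition reesM : {rmorphism rees -> {poly A}} := val.

Lemma integral_closure_rees x :
  integral_closure I x <-> integralOver reesM (x *: 'X).
Proof.
split=> [[n [a [n0 Ia xE]]]|[P mP]].
  have aP j : (if (0 < n - j)%N then a (n - j)%N *: 'X^(n - j) else 0)
              \in rees_pred.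
    apply/reesP => i; case: ifP => nj; last first.
      by rewrite coef0; case: (is_ideal_pow I i).
    rewrite coefZ coefXn; case: eqP => [->|_]; last first.
      by rewrite mulr0; case: (is_ideal_pow I i).
    by rewrite mulr1; apply: Ia; rewrite nj leq_subr.
  pose Q : {poly rees} := \poly_(j < n) Rees (aP j).
  have sQ : (size Q < size ('X^n : {poly rees}))%N.
    by rewrite size_polyXn ltnS size_poly.
  exists ('X^n + Q); first by rewrite monicE lead_coefDl // lead_coefXn.
  have -> : map_poly reesM ('X^n + Q) = 'X^n + map_poly reesM Q.
    by rewrite rmorphD; congr (_ + _); apply: map_polyXn.
  have Qv j : (map_poly rees_val Q)`_j = rees_val Q`_j.
    exact: (coef_map reesM).
  rewrite /root hornerD hornerXn (@horner_coef_wide _ n); last first.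
    exact: leq_trans (size_poly _ _) (size_poly _ _).
  have -> : (x *: 'X) ^+ n +
      \sum_(i < n) (map_poly reesM Q)`_i * (x *: 'X) ^+ i =
      (x ^+ n + \sum_(1 <= i < n.+1) a i * x ^+ (n - i)) *: 'X^n.
    rewrite exprZn scalerDl; congr (_ + _).
    rewrite big_add1 /= big_mkord scaler_suml (reindex_inj rev_ord_inj) /=.
    apply: eq_bigr => i _; have li := ltn_ord i.
    rewrite Qv coef_poly ltn_subrL n0 /= subKn // exprZn.
    by rewrite -scalerAl -scalerAr scalerA -exprD subnKC.
  by rewrite xE scale0r.
set Q := map_poly _ P => rQ.
have mQ : Q \is monic by apply: monic_map.
have Qi i : Q`_i \in rees_pred by rewrite coef_map; apply: (valP P`_i).
have sQ : (1 < size Q)%N by apply: root_size_gt1 rQ; apply: monic_neq0.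
pose n := (size Q).-1; have n0 : (0 < n)%N by rewrite -ltnS prednK // ltnW.
exists n, (fun i => Q`_(n - i)`_i); split=> // [i _|].
  by have /reesP := Qi (n - i)%N.
have /eqP/(congr1 (fun p : {poly A} => p`_n)) := rQ.
rewrite horner_coef coef0 -[size Q](@prednK _ (ltnW sQ)) -/n.
rewrite coef_sum big_ord_recr /= addrC; apply: etrans.
rewrite big_add1 /= big_mkord (reindex_inj rev_ord_inj) /=; congr (_ + _).
  have -> : Q`_n = 1 by apply/eqP.
  by rewrite mul1r exprZn coefZ coefXn eqxx mulr1.
apply: eq_bigr => i _; have li := ltn_ord i.
rewrite exprZn -scalerAr coefZ coefMXn ltnNge ltnW //= subnSK //.
by rewrite mulrC subKn // ltnW.
Qed.

Lemma integral_closure_pow_rees i a :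
    ideal_pow (integral_closure I) i a ->
  integralOver reesM (a *: 'X^i).
Proof.
elim: i a => [|i IHi] a.
  move=> _; have ra : a *: 'X^0 \in rees_pred.
    apply/reesP => i; rewrite expr0 alg_polyC coefC.
    by case: i => // i; case: (is_ideal_pow I i.+1).
  exact: (integral_id reesM (Rees ra)).
rewrite [ideal_pow _ _]/=; elim/ideal_mul_sub: a / => [|a b|a b /integral_closure_rees Ha /IHi Hb].
- by rewrite scale0r; apply: integral0.
- by rewrite scalerDl; apply: integral_add.
have := integral_mul Ha Hb.
by rewrite -scalerAl -scalerAr scalerA -exprS.
Qed.

Lemma integral_closureD_nz x y :
  integral_closure I x -> integral_closure I y -> integral_closure I (x + y).
Proof.
rewrite !integral_closure_rees scalerDl; exact: integral_add.
Qed.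

Lemma integral_closure_idem_nz x :
  integral_closure (integral_closure I) x -> integral_closure I x.
Proof.
move=> [n [a [n0 Ia xE]]]; apply/integral_closure_rees.
pose Q : {poly {poly A}} :=
  \poly_(j < n) (a (n - j)%N *: 'X^(n - j)).
have sQ : (size Q < size ('X^n : {poly {poly A}}))%N.
  by rewrite size_polyXn ltnS size_poly.
apply: (@integral_root_monic _ _ _ _ ('X^n + Q)).
- by rewrite monicE lead_coefDl // lead_coefXn.
- rewrite /root hornerD hornerXn (@horner_coef_wide _ n) ?size_poly //.
  have -> : (x *: 'X) ^+ n + \sum_(i < n) Q`_i * (x *: 'X) ^+ i =
      (x ^+ n + \sum_(1 <= i < n.+1) a i * x ^+ (n - i)) *: 'X^n.
    rewrite exprZn scalerDl; congr (_ + _).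
    rewrite big_add1 /= big_mkord scaler_suml (reindex_inj rev_ord_inj) /=.
    apply: eq_bigr => i _; have li := ltn_ord i.
    rewrite coef_poly /= ltn_subrL n0 /= subKn // exprZn.
    by rewrite -scalerAl -scalerAr scalerA -exprD subnKC.
  by rewrite xE scale0r.
apply/integral_poly => i; rewrite coefD coefXn coef_poly.
apply: integral_add; first exact: integral_nat.
case: ifP => ltin; last exact: integral0.
by apply: integral_closure_pow_rees; apply: Ia; rewrite subn_gt0 ltin leq_subr.
Qed.

End Rees.

Section Closure.
Variable A : comPzRingType.
Implicit Types (I J K : set A) (x y : A).

Lemma integral_closureD I x y :
  integral_closure I x -> integral_closure I y -> integral_closure I (x + y).
Proof.
have [e|nz] := eqVneq (1 : A) 0.
  by move=> _ _; rewrite -[x + y]mulr1 e mulr0; apply: integral_closure0.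
pose B : comNzRingType := HB.pack (A : Type) (GRing.ComPzRing.on A)
  (GRing.PzSemiRing_isNonZero.Build A nz).
exact: (@integral_closureD_nz B I x y).
Qed.

Lemma integral_closure_idem I :
  integral_closure (integral_closure I) = integral_closure I.
Proof.
apply/seteqP; split=> [x|]; last exact: sub_integral_closure.
have [e|nz] := eqVneq (1 : A) 0.
  by move=> _; rewrite -[x]mulr1 e mulr0; apply: integral_closure0.
pose B : comNzRingType := HB.pack (A : Type) (GRing.ComPzRing.on A)
  (GRing.PzSemiRing_isNonZero.Build A nz).
exact: (@integral_closure_idem_nz B I x).
Qed.

Lemma is_ideal_closure I : is_ideal I -> is_ideal (integral_closure I).
Proof.
move=> idI; split=> [||a x Hx].
- exact: integral_closure0.
- exact: integral_closureD.
have := integral_closureZ (J := setT) Hx Logic.I (y := a).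
by rewrite ideal_mulC ideal_mul1 // mulrC.
Qed.

Lemma integral_closure_mull I J :
  integral_closure (ideal_mul (integral_closure I) J) =
  integral_closure (ideal_mul I J).
Proof.
apply/seteqP; split; last first.
  by apply/integral_closureS/ideal_mulS => //; apply: sub_integral_closure.
rewrite -[X in _ `<=` X]integral_closure_idem; apply: integral_closureS.
apply: ideal_mul_sub; [exact: integral_closure0|exact: integral_closureD|].
by move=> x y; apply: integral_closureZ.
Qed.

Lemma integral_closure_mulr I J :
  integral_closure (ideal_mul I (integral_closure J)) =
  integral_closure (ideal_mul I J).
Proof.
by rewrite ideal_mulC integral_closure_mull ideal_mulC.
Qed.

Lemma integral_closureT : integral_closure (@setT A) = setT.
Proof. by apply/seteqP; split=> // x; apply: sub_integral_closure. Qed.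

Lemma nonzerodivisor1 : nonzerodivisor (1 : A).
Proof. by move=> y; rewrite mul1r. Qed.

Lemma nonzerodivisorM x y :
  nonzerodivisor x -> nonzerodivisor y -> nonzerodivisor (x * y).
Proof. by move=> rx ry z; rewrite -mulrA => /rx/ry. Qed.

Definition ic_one : ic A :=
  IC (is_ideal_setT A) integral_closureT
     (ex_intro2 _ _ 1 Logic.I nonzerodivisor1).

Lemma ic_mul_regular (I J : ic A) :
  exists2 x, integral_closure (ideal_mul I J) x & nonzerodivisor x.
Proof.
have [x Ix rx] := ic_regular I; have [y Jy ry] := ic_regular J.
exists (x * y); last exact: nonzerodivisorM.
by apply/sub_integral_closure/ideal_mulM.
Qed.

Definition ic_mul (I J : ic A) : ic A :=
  IC (is_ideal_closure (is_ideal_mul I (ic_ideal J)))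
     (integral_closure_idem (ideal_mul I J))
     (ic_mul_regular I J).

Lemma ic_mulC : commutative ic_mul.
Proof. by move=> I J; apply: ic_inj; rewrite /= ideal_mulC. Qed.

Lemma ic_mulA : associative ic_mul.
Proof.
move=> I J K; apply: ic_inj.
by rewrite /= integral_closure_mulr integral_closure_mull ideal_mulA.
Qed.

Lemma ic_mul1 : left_id ic_one ic_mul.
Proof.
move=> I; apply: ic_inj => /=.
by rewrite ideal_mul1 ?ic_closed //; apply: ic_ideal.
Qed.

Lemma ic_mulr1 : right_id ic_one ic_mul.
Proof. by move=> I; rewrite ic_mulC ic_mul1. Qed.

End Closure.

HB.instance Definition _ (A : comPzRingType) := gen_eqMixin (ic A).
HB.instance Definition _ (A : comPzRingType) := gen_choiceMixin (ic A).
HB.instance Definition _ (A : comPzRingType) :=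
  isMonoid.Build (ic A) (@ic_mulA A) (@ic_mul1 A) (@ic_mulr1 A).

Lemma ic_expE (A : comPzRingType) (I : ic A) (n : nat) :
  ic_set (I ^+ n)%g = integral_closure (ideal_pow I n).
Proof.
elim: n => [|n IHn]; first by rewrite /= integral_closureT.
by rewrite expgS /= IHn integral_closure_mulr.
Qed.

Definition conical (M : monoidType) : Prop :=
  forall a b : M, (a * b = 1)%g -> a = 1%g /\ b = 1%g.

Definition invertible (M : monoidType) (a : M) : Prop :=
  exists b : M, (a * b = 1)%g /\ (b * a = 1)%g.

Definition reduced (M : monoidType) : Prop :=
  forall a : M, invertible a -> a = 1%g.

Definition torsion_free (M : monoidType) : Prop :=
  forall (a b : M) (n : nat), (1 <= n)%N -> (a ^+ n = b ^+ n)%g -> a = b.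

(* Main.v *)
Require Import Defs.
From mathcomp Require Import all_boot all_order all_algebra.
From mathcomp Require Import classical_sets.

(** An equation of integral dependence of [1] over [K] puts [1] in [K], so
    [ic A] is conical, hence reduced.  For torsion-freeness, an equation of
    integral dependence of [x ^+ n] over [J^n] is one of [x] over [J]; so if
    the closures of [I^n] and [J^n] agree, every [x] in [I] is integral
    over [J]. *)

Import GRing.Theory.
Local Open Scope ring_scope.
Local Open Scope classical_set_scope.

Section IntegralClosure.
Context {A : comPzRingType}.
Implicit Types (I J : set A) (x : A).

Lemma ideal_mul_subl I J : is_ideal I -> ideal_mul I J `<=` I.
Proof.
case=> I0 ID IM; apply: ideal_mul_sub => // x y Ix _.
by rewrite mulrC; apply: IM.
Qed.

Lemma ideal_mul_subr I J : is_ideal J -> ideal_mul I J `<=` J.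
Proof. by rewrite ideal_mulC; apply: ideal_mul_subl. Qed.

(** The equation at 1 makes 1 minus the sum of the [a i]. Their indices start at 1, so each lies in
    a positive power of [I], hence in [I]. *)
Lemma integral_closure_1 I : is_ideal I -> integral_closure I 1 -> I 1.
Proof.
move=> idI; have [I0 ID IM] := idI.
move=> [n [a [_ Ia]]]; rewrite expr1n => /eqP; rewrite addr_eq0 => /eqP ->.
rewrite -mulN1r; apply: IM; rewrite big_nat; elim/big_ind: _ => // i.
rewrite expr1n mulr1 ltnS => i1n; have := Ia i i1n.
by case: i i1n => // i _; apply: ideal_mul_subl.
Qed.

Lemma ideal_pow_mul I n i : ideal_pow (ideal_pow I n) i `<=` ideal_pow I (i * n).
Proof.
elim: i => //= i IHi; have [P0 PD _] := is_ideal_pow I (i.+1 * n).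
by apply: ideal_mul_sub => // x y Ix /IHi; rewrite mulSn; apply: ideal_powD.
Qed.

(** Serves to discard the zero coefficients of an equation in [x ^+ n] read as one in [x]. *)
Lemma sum_nat_dvdn (F : nat -> A) n m : (0 < n)%N ->
  \sum_(1 <= k < (m * n).+1 | (n %| k)%N) F k = \sum_(1 <= i < m.+1) F (i * n)%N.
Proof.
move=> n0; elim: m => [|m IHm]; first by rewrite !big_geq.
rewrite [RHS]big_nat_recr //= -IHm (@big_cat_nat _ _ _ (m * n).+1) //=; last first.
  by rewrite ltnS leq_mul2r leqnSn orbT.
(* In the block from [m * n + 1] to [m.+1 * n], only the last index is a multiple of [n]. *)
congr (_ + _); rewrite big_mkcond big_nat_recr /=; last first.
  by rewrite mulSn -[X in (X < _)%N]add0n ltn_add2r.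
rewrite dvdn_mull // big_nat big1 ?add0r // => k /andP[lo hi].
case: ifP => // /dvdnP[q kE]; move: lo hi.
by rewrite kE !ltn_mul2r n0 /= ltnS => /leq_trans/[apply]; rewrite ltnn.
Qed.

Lemma integral_closure_root J n x : (0 < n)%N ->
  integral_closure (ideal_pow J n) (x ^+ n) -> integral_closure J x.
Proof.
move=> n0 [m [a [m0 Ja xE]]].
(* The coefficient [a i] moves to index [i * n], where it fits because [(J^n)^i] lies in
   [J^(i * n)]; the gaps are filled with 0. *)
exists (m * n)%N, (fun k => if (n %| k)%N then a (k %/ n)%N else 0).
split=> [|k /andP[k0 kmn]|]; first by rewrite muln_gt0 m0.
  case: ifP => [/dvdnP[i kE]|_]; last by case: (is_ideal_pow J k).
  move: k0 kmn; rewrite kE mulnK // muln_gt0 leq_pmul2r // n0 andbT => i0 im.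
  by apply: ideal_pow_mul; apply: Ja; rewrite i0.
rewrite -[RHS]xE -exprM mulnC; congr (_ + _).
rewrite mulnC.
under eq_bigr => k _ do rewrite (fun_if ( *%R^~ _)) mul0r.
rewrite -big_mkcond sum_nat_dvdn //; apply: eq_bigr => i _.
by rewrite mulnK // -mulnBl mulnC exprM.
Qed.

End IntegralClosure.

Lemma ic_conical (A : comPzRingType) : conical (ic A).
Proof.
move=> I J /(congr1 (@ic_set A)) /= IJ1.
have idIJ := is_ideal_mul I (ic_ideal J).
have IJ_1 : ideal_mul I J 1 by apply: integral_closure_1; rewrite ?IJ1.
(* The identity of [ic A] is the unit ideal, and 1 lies in both factors since [IJ] is contained in
   each. *)
have eq1 (K : ic A) : ic_set K 1 -> K = 1%g.
  move=> K1; apply: ic_inj; apply/seteqP; split=> // x _.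
  by rewrite -[x]mulr1; case: (ic_ideal K) => _ _; apply.
split; apply: eq1.
  exact: ideal_mul_subl (ic_ideal I) _ IJ_1.
exact: ideal_mul_subr (ic_ideal J) _ IJ_1.
Qed.

Lemma conical_reduced (M : monoidType) : conical M -> reduced M.
Proof. by move=> conM a [b [/conM[]]]. Qed.

Lemma ic_torsion_free (A : comPzRingType) : torsion_free (ic A).
Proof.
have sub (I J : ic A) n : (0 < n)%N -> (I ^+ n = J ^+ n)%g -> I `<=` J.
  move=> n0 /(congr1 (@ic_set A)); rewrite !ic_expE => IJ x Ix.
  (* As [J] is closed, integrality of [x] over [J] suffices; [x ^+ n] lies in [I^n], hence in the
     common closure. *)
  rewrite -(ic_closed J); apply: integral_closure_root n0 _.
  by rewrite -IJ; apply/sub_integral_closure/ideal_powX.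
move=> I J n n0 IJ; apply: ic_inj; apply/seteqP.
by split; [apply: sub IJ|apply: sub (esym IJ)].
Qed.

Theorem proposition3p1 (A : comPzRingType) (noethA : noetherian A) :
  [/\ conical (ic A), reduced (ic A) & torsion_free (ic A)].
Proof.
split; [exact: ic_conical | exact/conical_reduced/ic_conical |].
exact: ic_torsion_free.
Qed.
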